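(* Let $\varphi$ be a Scott function on $\mathbb{K}$ and let $\mathcal{H}$ be a closed subset of $\mathcal{S}$. If $\varphi$ is approximated over $\mathcal{H}$ by some net of Radon measures on $\mathcal{S}$, then there exists a Radon measure $\mu$ on $\mathcal{S}$ with $\mu(\mathcal{S})=1$ that represents $\varphi$ over $\mathcal{H}$.
   Context: A dcpo is a poset in which every (nonempty) directed subset has a supremum. In a dcpo, $x\ll y$ means that every directed $E$ with $y\le\sup E$ contains some $w$ with $x\le w$. A domain is a dcpo in which, for each $x$, the set $\{z: z\ll x\}$ is a directed lower set with supremum $x$. A subset $U$ is Scott open if it is an upper set and meets every directed $E$ with $\sup E\in U$. The Lawson topology has as subbase the Scott open sets together with the complements of the principal upper sets $\{z: x\le z\}$. $\mathbb{K}$ is a domain which is also a lattice with top element $\hat1$, such that $\hat1\ll\hat1$ and $\ll$ is multiplicative: $a\ll x$, $b\ll y$ imply $a\wedge b\ll x\wedge y$. $\mathcal{S}$ is the set of nonempty Scott open subsets of $\mathbb{K}$ ordered by inclusion; it is a continuous lattice and is given its Lawson topology, which is compact Hausdorff. For $x\in\mathbb{K}$, $\mathcal{S}_x=\{U\in\mathcal{S}: x\in U\}$, which is open in $\mathcal{S}$. A Radon measure is a Borel measure, finite on compact sets, inner regular on open sets and outer regular on Borel sets. A Scott function is a function $\varphi:\mathbb{K}\to[0,\infty)$ that is Scott-continuous, i.e. $\varphi(x)=\sup_{z\ll x}\varphi(z)$ for all $x$ (in particular it is increasing), normalized so that $\varphi(\hat1)=1$. A net $\{\mu_F\}$ of Radon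 measures on $\mathcal{S}$ indexed by the finite subsets $F$ of $\mathbb{K}$ (directed by inclusion) approximates $\varphi$ over $\mathcal{H}$ if each $\mu_F$ is supported by $\mathcal{H}$, i.e. $\mu_F(\mathcal{S}\setminus\mathcal{H})=0$, and $\varphi(x)=\mu_F(\mathcal{S}_x)$ for all $x\in F$. A Radon measure $\mu$ on $\mathcal{S}$ represents $\varphi$ over $\mathcal{H}$ if $\mu(\mathcal{S}\setminus\mathcal{H})=0$ and $\varphi(x)=\mu(\mathcal{H}\cap\mathcal{S}_x)$ for all $x\in\mathbb{K}$. *)

(* Defs.v *)
From HB Require Import structures.
From mathcomp Require Import all_boot all_order all_algebra finmap.
From mathcomp Require Import all_classical all_reals all_analysis.

Set Implicit Arguments.
Unset Strict Implicit.
Unset Printing Implicit Defensive.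

Import Order.TTheory GRing.Theory Num.Theory.

Local Open Scope classical_set_scope.
Local Open Scope ring_scope.

Section DomainTheory.
Context {d : Order.disp_t} {T : porderType d}.
Implicit Types (x y z : T) (E U : set T).

Definition directed E : Prop :=
  E !=set0 /\
  forall x y, E x -> E y -> exists z, [/\ E z, (x <= z)%O & (y <= z)%O].

Definition upper_set U : Prop := forall x y, U x -> (x <= y)%O -> U y.

Definition lower_set U : Prop := forall x y, U y -> (x <= y)%O -> U x.

Definition way_below x y : Prop :=
  forall E s, directed E -> isLub E s -> (y <= s)%O ->
    exists2 w, E w & (x <= w)%O.

Definition scott_open U : Prop :=
  upper_set U /\
  forall E s, directed E -> isLub E s -> U s -> E `&` U !=set0.

Definition lawson_subbase : set (set T) :=
  [set U | scott_open U] `|` [set ~` [set z | (x <= z)%O] | x in [set: T]].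

End DomainTheory.

Definition dcpo {d : Order.disp_t} (T : porderType d) : Prop :=
  forall E : set T, directed E -> exists s, isLub E s.

Definition domain {d : Order.disp_t} (T : porderType d) : Prop :=
  dcpo T /\
  forall x : T, let B := [set z | way_below z x] in
    [/\ directed B, lower_set B & isLub B x].

Definition way_below_multiplicative {d : Order.disp_t} (K : latticeType d)
  : Prop :=
  forall a b x y : K, way_below a x -> way_below b y ->
    way_below (Order.meet a b) (Order.meet x y).

Definition nonempty_scott_open {d : Order.disp_t} (K : porderType d)
  : set (set K) := [set U | scott_open U /\ U !=set0].

Definition scott_opens {d : Order.disp_t} (K : porderType d) : Type :=
  set_type (@nonempty_scott_open d K).

Section ScottOpens.
Context {d : Order.disp_t} (K : porderType d).

HB.instance Definition _ :=
  SubChoice.copy (scott_opens K) (set_type (@nonempty_scott_open d K)).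

(* The order inherited from [set K], that is, inclusion. *)
HB.instance Definition _ :=
  [SubChoice_isSubPOrder of scott_opens K by <: with set_display].

HB.instance Definition _ :=
  @isSubBaseTopological.Build (scott_opens K) (set (scott_opens K))
    (@lawson_subbase _ (scott_opens K)) id.

Lemma scott_opens_leE (U V : scott_opens K) :
  (U <= V)%O = (val U `<=` val V) :> Prop.
Proof. exact: subsetEset. Qed.

Definition scott_opens_at (x : K) : set (scott_opens K) := [set U | val U x].

End ScottOpens.

Section ScottOpensPointed.
Context {d : Order.disp_t} (K : tLatticeType d).

Lemma nonempty_scott_open_setT : [set: K] \in @nonempty_scott_open d K.
Proof.
apply/mem_set; split; last by exists \top%O.
by split=> // E s [[x Ex] _] _ _; exists x.
Qed.

(* Needed only because the library's measurable types are pointed. *)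
HB.instance Definition _ := isPointed.Build (scott_opens K)
  (exist _ [set: K] nonempty_scott_open_setT : scott_opens K).

End ScottOpensPointed.

Notation borel T := (g_sigma_algebraType (@open T)).

(* Library measures are total functions with unconstrained values off the
   sigma-algebra, hence the restriction to Borel compact sets; it is vacuous in
   a Hausdorff space, where compact sets are closed. *)
Definition radon (R : realType) (T : ptopologicalType)
    (mu : {measure set (borel T) -> \bar R}) : Prop :=
  [/\ forall C : set (borel T), compact (C : set T) -> measurable C ->
        (mu C < +oo)%E,
      forall U : set (borel T), open (U : set T) ->
        mu U = ereal_sup [set mu C | C in
          [set C : set (borel T) |
             [/\ compact (C : set T), measurable C & C `<=` U]]] &
      forall A : set (borel T), measurable A ->
        mu A = ereal_inf [set mu U | U in
          [set U : set (borel T) | open (U : set T) /\ A `<=` U]]].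

Definition scott_function (R : realType) {d : Order.disp_t}
    (K : tLatticeType d) (phi : K -> R) : Prop :=
  [/\ forall x, (0 <= phi x)%R,
      forall x, (phi x)%:E =
        ereal_sup [set (phi z)%:E | z in [set z | way_below z x]] &
      phi \top%O = 1%R].

Definition approximates (R : realType) {d : Order.disp_t}
    (K : tLatticeType d)
    (mu : {fset K} -> {measure set (borel (scott_opens K)) -> \bar R})
    (phi : K -> R) (H : set (scott_opens K)) : Prop :=
  forall F : {fset K},
    [/\ radon (mu F), mu F (~` H) = 0%E &
        forall x, x \in F -> (phi x)%:E = mu F (scott_opens_at x)].

Definition represents (R : realType) {d : Order.disp_t}
    (K : tLatticeType d)
    (mu : {measure set (borel (scott_opens K)) -> \bar R})
    (phi : K -> R) (H : set (scott_opens K)) : Prop :=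
  [/\ radon mu, mu (~` H) = 0%E &
      forall x, (phi x)%:E = mu (H `&` scott_opens_at x)].

(* Main.v *)
(* A probability measure representing [phi] is a vague cluster point of the
   approximating net. Along an ultrafilter containing the tails of the net, the
   measures converge setwise to a finitely additive [lam]. The Lawson topology is
   compact Hausdorff, so the inner regular set function
   [U |-> sup {lam C | C closed, C `<=` U}] on open sets induces an outer measure
   whose restriction to the Borel sets is a Radon measure [nu] with [nu <= lam] on
   open sets and [lam <= nu] on closed sets. These two bounds yield the mass, the
   support and [nu S_x <= phi x]. Conversely, for [z << x] the closed set of all
   [V] containing [{w | z << w}] lies between [S_z] and [S_x], so that
   [phi z <= nu S_x], and [phi] is Scott continuous. *)
From HB Require Import structures.
Require Import Defs.
From mathcomp Require Import all_boot all_order all_algebra finmap.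
From mathcomp Require Import all_classical all_reals all_analysis.

Set Implicit Arguments.
Unset Strict Implicit.
Unset Printing Implicit Defensive.

Import Order.TTheory GRing.Theory Num.Theory.
Import numFieldNormedType.Exports.

Local Open Scope classical_set_scope.
Local Open Scope ring_scope.

(** * Interpolation for the way-below relation and its Scott open sets *)

Section WayBelow.
Context {d : Order.disp_t} {T : porderType d}.
Implicit Types (x y z : T) (U : set T).

Lemma way_below_le x y z : way_below x y -> (y <= z)%O -> way_below x z.
Proof. by move=> xy yz E s dE Es /(le_trans yz); exact: xy. Qed.

Lemma way_belowW x y : way_below x y -> (x <= y)%O.
Proof.
move=> /(_ [set y] y)[|||w -> //]; last exact: lexx.
- by split; [exists y|move=> ? ? -> ->; exists y].
- by split=> [? -> //|b]; exact.
Qed.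

Context (domT : domain T).

(** The elements lying two way-below steps under [x] form a directed set [E] with supremum [x];
    applying [z << x] to [E] gives an element above [z] together with its intermediate point. *)
Lemma way_below_interpolation x z : way_below z x ->
  exists2 w, way_below z w & way_below w x.
Proof.
have [_ app] := domT; have [dx _ [ubx lubx]] := app x.
pose E := [set u | exists2 w, way_below u w & way_below w x].
have dE : directed E.
  split.
    have [[w wx] _] := dx; have [[[u uw] _] _ _] := app w.
    by exists u, w.
  move=> u1 u2 [w1 uw1 w1x] [w2 uw2 w2x].
  have [w [wx w1w w2w]] := dx.2 _ _ w1x w2x; have [dw _ _] := app w.
  have [u [uw u1u u2u]] :=
    dw.2 _ _ (way_below_le uw1 w1w) (way_below_le uw2 w2w).
  by exists u; split=> //; exists w.
move=> /(_ E x dE)[|//|u [w uw wx] zu].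
  split=> [u [w uw wx]|b ubE].
    exact: le_trans (way_belowW uw) (way_belowW wx).
  apply: lubx => w wx; have [_ _ [_ lubw]] := app w.
  by apply: lubw => u uw; apply: ubE; exists w.
exists w => //; have [_ low _] := app w; exact: low uw zu.
Qed.

Lemma scott_open_way_below z : scott_open [set w | way_below z w].
Proof.
split=> [x y|E s dE Es zs]; first exact: way_below_le.
have [w zw ws] := way_below_interpolation zs.
by have [e Ee we] := ws _ _ dE Es (lexx s); exists e; split=> //=;
  exact: way_below_le we.
Qed.

Lemma scott_open_way_belowP U x : scott_open U -> U x ->
  exists2 z, U z & way_below z x.
Proof.
move=> [_ oU] Ux; have [_ /(_ x)[dx _ lubx]] := domT.
by have [z [zx Uz]] := oU _ _ dx lubx Ux; exists z.
Qed.

End WayBelow.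

(** * Subbasic open and closed sets of the Lawson topology *)

Section ScottOpensTopology.
Context {d : Order.disp_t} {K : porderType d}.
Local Notation S := (scott_opens K).
Implicit Types (U V : S) (x z : K).

Lemma lawson_subbase_open (A : set S) : lawson_subbase A -> open A.
Proof.
move=> sA; exists [set A]; last by rewrite bigcup_set1.
by move=> _ ->; exact: (@finI_from1 _ _ lawson_subbase id).
Qed.

Lemma lawson_cvg (F : set_system S) U : Filter F ->
  (forall A, lawson_subbase A -> A U -> F A) -> F --> U.
Proof.
move=> FF FA A /=; rewrite nbhsE => -[_ [[B sB <-] [C BC CU]] sUA].
apply: filterS sUA _; apply: (@filterS _ _ _ C); first by move=> ? ?; exists C.
have /sB[D sD IDeC] := BC; rewrite -IDeC; apply: filter_bigI => E DE.
have /sD := DE; rewrite inE => sE; apply: FA => //.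
by move: CU; rewrite -IDeC => /(_ _ DE).
Qed.

Lemma scott_opensP U : scott_open (val U) /\ val U !=set0.
Proof. exact: set_mem (valP U). Qed.

Lemma scott_opens_surj (A : set K) : scott_open A -> A !=set0 ->
  exists U, val U = A.
Proof.
move=> oA A0; have mA : A \in @nonempty_scott_open d K by exact/mem_set.
by exists (exist _ A mA).
Qed.

(** A nonempty union of members of [S] is again Scott open and nonempty, hence an upper bound of [E]
    in [S]. Suprema in [S] are thus unions, which makes each [scott_opens_at x] Scott open. *)
Lemma isLub_scott_opens (E : set S) U : E !=set0 -> isLub E U ->
  val U `<=` \bigcup_(V in E) val V.
Proof.
move=> [V0 EV0] [_ lubU].
have [||W WE] := @scott_opens_surj (\bigcup_(V in E) val V).
- split=> [x y [V EV Vx] xy|D s dD Ds [V EV Vs]].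
    by exists V => //; have [[upV _] _] := scott_opensP V; exact: upV xy.
  have [[_ oV] _] := scott_opensP V; have [x [Dx Vx]] := oV _ _ dD Ds Vs.
  by exists x; split=> //; exists V.
- by have [_ [x V0x]] := scott_opensP V0; exists x, V0.
have := lubU W; rewrite scott_opens_leE WE; apply => V EV.
by rewrite /= scott_opens_leE WE; exact: bigcup_sup.
Qed.

Lemma open_scott_opens_at x : open (@scott_opens_at _ K x).
Proof.
apply: lawson_subbase_open; left; split=> [U V Ux|E U [E0 _] EU Ux].
  by rewrite scott_opens_leE; exact.
by have [V EV Vx] := isLub_scott_opens E0 EU Ux; exists V.
Qed.

Lemma closed_scott_opens_ge U : closed [set V : S | val U `<=` val V].
Proof.
rewrite -[X in closed X]setCK; apply: open_closedC; apply: lawson_subbase_open.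
by right; exists U => //; congr (~` _); apply/seteqP; split=> V /=;
  rewrite scott_opens_leE.
Qed.

End ScottOpensTopology.

(** * The Lawson topology is compact Hausdorff *)

Section ScottOpensCompact.
Context {d : Order.disp_t} {K : tLatticeType d}.
Context (domK : domain K) (top_way_below : way_below (\top%O : K) \top%O).
Local Notation S := (scott_opens K).
Implicit Types (U V : S) (x z : K).

Lemma scott_opens_top U : val U \top%O.
Proof.
by have [[upU _] [x Ux]] := scott_opensP U; apply: upU Ux _; exact: lex1.
Qed.

Lemma scott_opens_way_below z : exists U, val U = [set w | way_below z w].
Proof.
apply: scott_opens_surj; first exact: scott_open_way_below.
exists \top%O => /=; have [_ low _] := domK.2 \top%O.
exact: low top_way_below (lex1 _).
Qed.

Lemma scott_opens_bigcup_way_below (A : set K) : A \top%O -> exists U,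
  val U = \bigcup_(z in A) [set w | way_below z w].
Proof.
move=> Atop; apply: scott_opens_surj; last by exists \top%O, \top%O.
split=> [x y [z sz zx] xy|E t dE Et [z sz zt]].
  by exists z => //; exact: way_below_le xy.
have [_ oz] := scott_open_way_below domK z.
by have [e [Ee ze]] := oz _ _ dE Et zt; exists e; split=> //; exists z.
Qed.

(* The sets [scott_opens_at z] form a subbase of the Scott topology: [U] is the
   directed union of the finite unions of the sets [{w | z << w}] with [z] in
   [U], and any [V] containing those finitely many [z] contains the union. *)
Lemma scott_open_scott_opens (O : set S) U : scott_open O -> O U ->
  exists2 s : {fset K}, [set` s] `<=` val U &
    \bigcap_(z in [set` s]) @scott_opens_at _ K z `<=` O.
Proof.
move=> [upO inO] OU.
pose B (s : {fset K}) := \bigcup_(z in [set` s]) [set w | way_below z w].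
(* Having [\top] in [s] puts [\top] into [B s], since [\top << \top]; so [B s] is nonempty and
   defines a point of [S]. *)
have exB (s : {fset K}) : \top%O \in s -> exists V : S, val V = B s.
  by move=> s1; apply: scott_opens_bigcup_way_below.
pose E := [set V : S | exists2 s : {fset K},
  \top%O \in s /\ [set` s] `<=` val U & val V = B s].
have [E0 dE] : directed E.
  split.
    have [V VE] := exB [fset \top%O]%fset (fset11 _).
    exists V, [fset \top%O]%fset => //; split; first exact: fset11.
    by move=> z /fset1P ->; exact: scott_opens_top.
  move=> V1 V2 [s1 [s1top Us1] V1E] [s2 [s2top Us2] V2E].
  have sl := fsubsetUl s1 s2; have sr := fsubsetUr s1 s2.
  have [V VE] := exB (s1 `|` s2)%fset (fsubsetP sl _ s1top).
  exists V; split.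
  - exists (s1 `|` s2)%fset => //; split; first exact: fsubsetP sl _ s1top.
    by move=> z /fsetUP[/Us1|/Us2].
  - by rewrite scott_opens_leE VE V1E; apply: bigcup_subset; exact/fsubsetP.
  - by rewrite scott_opens_leE VE V2E; apply: bigcup_subset; exact/fsubsetP.
have EU : isLub E U.
  have [oU _] := scott_opensP U.
  split=> [V [s [_ Us] VE]|V ubV]; rewrite scott_opens_leE.
    by rewrite VE => w [z /Us Uz zw]; exact: oU.1 Uz (way_belowW zw).
  move=> w Uw; have [z Uz zw] := scott_open_way_belowP domK oU Uw.
  have [W WE] := exB [fset \top%O; z]%fset (fset21 _ _).
  have : (W <= V)%O.
    apply: ubV; exists [fset \top%O; z]%fset => //; split; first exact: fset21.
    by move=> y /fset2P[->|-> //]; exact: scott_opens_top.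
  by rewrite scott_opens_leE WE; apply; exists z => //; exact: fset22.
have [V [[s [_ Us] VE] OV]] := inO E U (conj E0 dE) EU OU.
exists s => // W sW; apply: upO OV _; rewrite scott_opens_leE VE => w [z sz zw].
by have [[upW _] _] := scott_opensP W; exact: upW (sW _ sz) (way_belowW zw).
Qed.

Lemma compact_scott_opens : compact [set: S].
Proof.
rewrite compact_ultra => F FU _.
(* [L] is the limit of the ultrafilter [F]. The step [z << x] makes it Scott open; it contains
   [\top] because [\top << \top] and every member of [S] contains [\top]. *)
pose L := [set x | exists2 z, way_below z x & F (@scott_opens_at _ K z)].
have [||U UL] := @scott_opens_surj _ _ L.
- split=> [x y [z zx Fz] xy|E x dE Ex [z zx Fz]].
    by exists z => //; exact: way_below_le xy.
  have [_ oz] := scott_open_way_below domK z.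
  by have [e [Ee ze]] := oz _ _ dE Ex zx; exists e; split=> //; exists z.
- exists \top%O, \top%O => //; apply: filterS filterT => V _.
  exact: scott_opens_top.
exists U; split=> //; apply: lawson_cvg => A [oA AU|[V _ <-] VU].
  have [s Us sA] := scott_open_scott_opens oA AU.
  apply: filterS sA _; apply: filter_bigI.
  move=> z /Us; rewrite UL => -[y yz Fy]; apply: filterS Fy => W.
  by have [[upW _] _] := scott_opensP W; move=> /upW; apply; exact: way_belowW.
(* For the subbasic complements: with [z << x] and [z] in [V], membership of [S_z] in [F] would put
   [x] in [L]. Hence [F] contains the complement of [S_z], none of whose members includes [V]. *)
have [x Vx Lx] : exists2 x, val V x & ~ L x.
  apply: contrapT => VL; apply: VU; rewrite /= scott_opens_leE UL => x Vx.
  by apply: contrapT => Lx; apply: VL; exists x.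
have [oV _] := scott_opensP V.
have [z Vz zx] := scott_open_way_belowP domK oV Vx.
have [Fz|Fz] := in_ultra_setVsetC (@scott_opens_at _ K z) FU.
  by exfalso; apply: Lx; exists z.
by apply: filterS Fz => W Wz; rewrite /= scott_opens_leE => /(_ _ Vz).
Qed.

(** A closed set squeezed between two open ones: it serves both to separate points and to bound the
    limit measure of [S_x] from below. *)
Lemma scott_opens_at_sub_ge x z U : val U = [set w | way_below z w] ->
  way_below z x ->
  @scott_opens_at _ K z `<=` [set V | val U `<=` val V] /\
  [set V : S | val U `<=` val V] `<=` @scott_opens_at _ K x.
Proof.
move=> UE zx; split=> V; last by apply; rewrite UE.
move=> Vz; rewrite /= UE => w zw; have [[upV _] _] := scott_opensP V.
exact: upV Vz (way_belowW zw).
Qed.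

(** If [x] lies in [U] but not in [V], choose [z << x] in [U]; the closed set between [S_z] and
    [S_x] contains a neighbourhood of [U] and misses [V]. *)
Lemma hausdorff_scott_opens : hausdorff_space S.
Proof.
have sep U V x : val U x -> ~ val V x ->
    exists A, exists B, [/\ open A, open B, A U, B V & A `&` B = set0].
  move=> Ux Vx; have [oU _] := scott_opensP U.
  have [z Uz zx] := scott_open_way_belowP domK oU Ux.
  have [W WE] := scott_opens_way_below z.
  have [zW Wx] := scott_opens_at_sub_ge WE zx.
  exists (@scott_opens_at _ K z), (~` [set V | val W `<=` val V]); split=> //.
  - exact: open_scott_opens_at.
  - exact/closed_openC/closed_scott_opens_ge.
  - by move=> /Wx.
  - by apply/disjoints_subset; rewrite setCK.
rewrite open_hausdorff => U V /eqP UV.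
have [UV'|/existsNP[x /not_implyP[Ux Vx]]] := pselect (val U `<=` val V); last first.
  have [A [B [oA oB AU BV AB]]] := sep _ _ _ Ux Vx.
  by exists (A, B); [split; exact/mem_set|split=> //; exact/eqP].
have [VU|/existsNP[x /not_implyP[Vx Ux]]] := pselect (val V `<=` val U).
  by exfalso; apply: UV; apply/val_inj/seteqP.
have [A [B [oA oB AU BV AB]]] := sep _ _ _ Vx Ux.
by exists (B, A); [split; exact/mem_set|split=> //; rewrite setIC; exact/eqP].
Qed.

End ScottOpensCompact.

(** * Extension of a content on closed sets to a Radon measure *)

Lemma open_borel (T : ptopologicalType) (U : set T) :
  open U -> measurable (U : set (borel T)).
Proof. exact: sub_sigma_algebra. Qed.

Lemma closed_borel (T : ptopologicalType) (C : set T) :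
  closed C -> measurable (C : set (borel T)).
Proof.
move=> cC; rewrite -[C]setCK; apply: measurableC; apply: open_borel.
exact: closed_openC.
Qed.

Section ContentExtension.
Context {R : realType} {T : ptopologicalType} (lam : set T -> R).
Context (hausT : hausdorff_space T) (compactT : compact [set: T]).
Context (lam0 : lam set0 = 0)
  (lam_le : forall C D, closed C -> closed D -> C `<=` D -> lam C <= lam D)
  (lamU_le : forall C D, closed C -> closed D ->
    lam (C `|` D) <= lam C + lam D)
  (lamU : forall C D, closed C -> closed D -> C `&` D = set0 ->
    lam (C `|` D) = lam C + lam D).
Implicit Types (A B C D U V : set T).
Local Open Scope ereal_scope.

(** As closed sets are compact here, [lam] is a content in the sense of Halmos; this is the inner
    content it induces, and [outer_content] is the associated outer measure. *)
Definition inner_content U : \bar R :=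
  ereal_sup [set (lam C)%:E | C in [set C | closed C /\ C `<=` U]].

Definition outer_content A : \bar R :=
  ereal_inf [set inner_content U | U in [set U | open U /\ A `<=` U]].

Lemma le_inner_content U V : U `<=` V -> inner_content U <= inner_content V.
Proof.
move=> UV; apply: ereal_sup_le => _ [C [cC CU] <-]; exists C => //; split=> //.
exact: subset_trans UV.
Qed.

Lemma inner_content_ge C U : closed C -> C `<=` U ->
  (lam C)%:E <= inner_content U.
Proof. by move=> cC CU; apply: ereal_sup_ubound; exists C. Qed.

Lemma inner_content_ge0 U : 0 <= inner_content U.
Proof.
by have := inner_content_ge closed0 (@sub0set _ U); rewrite lam0.
Qed.

Lemma inner_content0 : inner_content set0 = 0.
Proof.
apply/eqP; rewrite eq_le inner_content_ge0 andbT.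
by apply: ge_ereal_sup => _ [C [_ +] <-]; rewrite subset0 => ->; rewrite lam0.
Qed.

Lemma inner_content_ltoo U : inner_content U < +oo.
Proof.
apply: le_lt_trans (ltry (lam setT)); apply: ge_ereal_sup => _ [C [cC _] <-].
by rewrite lee_fin; apply: lam_le => //; exact: closedT.
Qed.

(** By normality, disjoint open sets [A] and [B] separate the parts of [C] outside [U] and outside
    [V]; removing [A], respectively [B], from [C] gives the two pieces. *)
Lemma closed_subset_openU C U V : closed C -> open U -> open V ->
  C `<=` U `|` V -> exists C1 C2, [/\ closed C1, closed C2, C1 `<=` U,
    C2 `<=` V & C = C1 `|` C2].
Proof.
move=> cC oU oV CUV.
have /(@normal_openP R) nT := compact_normal hausT compactT.
have [||| A [B [oA oB CA CB AB]]] := nT (C `&` ~` U) (C `&` ~` V).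
- by apply: closedI => //; exact: open_closedC.
- by apply: closedI => //; exact: open_closedC.
- by apply/seteqP; split=> // x [[Cx Ux] [_ Vx]]; case: (CUV _ Cx).
exists (C `&` ~` A), (C `&` ~` B); split.
- by apply: closedI => //; exact: open_closedC.
- by apply: closedI => //; exact: open_closedC.
- by move=> x [Cx Ax]; apply: contrapT => Ux; apply: Ax; exact: CA.
- by move=> x [Cx Bx]; apply: contrapT => Vx; apply: Bx; exact: CB.
- by rewrite -setIUr -setCI AB setC0 setIT.
Qed.

Lemma inner_contentU U V : open U -> open V ->
  inner_content (U `|` V) <= inner_content U + inner_content V.
Proof.
move=> oU oV; apply: ge_ereal_sup => _ [C [cC CUV] <-].
have [C1 [C2 [cC1 cC2 C1U C2V CE]]] := closed_subset_openU cC oU oV CUV.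
rewrite CE; apply: (@le_trans _ _ ((lam C1)%:E + (lam C2)%:E)).
  by rewrite -EFinD lee_fin lamU_le.
by apply: leeD; exact: inner_content_ge.
Qed.

Lemma inner_content_bigcup (F : (set T)^nat) : (forall n, open (F n)) ->
  inner_content (\bigcup_n F n) <= \sum_(n <oo) inner_content (F n).
Proof.
move=> oF; apply: ge_ereal_sup => _ [C [cC CF] <-].
have := subclosed_compact cC compactT (@subsetT _ C).
rewrite compact_cover => /(_ nat setT F)[n _|x /CF|D _ CD]; [exact: oF|by []|].
(* The finite subcover [D] is enlarged to an initial segment; the successor keeps the largest index
   in range. *)
have CD' : C `<=` \big[setU/set0]_(n < (\max_(i <- D) i).+1) F n.
  move=> x /CD [n nD Fx]; rewrite -bigcup_mkord; exists n => //=.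
  by rewrite ltnS; exact: leq_bigmax_seq.
have finle n : inner_content (\big[setU/set0]_(i < n) F i) <=
    \sum_(i < n) inner_content (F i).
  elim: n => [|n IH].
    by rewrite !big_ord0 inner_content0.
  rewrite !big_ord_recr /=; apply: le_trans (leeD2r _ IH).
  by apply: inner_contentU => //; rewrite -bigcup_mkord; exact: bigcup_open.
apply: le_trans (inner_content_ge cC CD') _; apply: le_trans (finle _) _.
by rewrite -(big_mkord xpredT (inner_content \o F)); apply: nneseries_lim_ge => n _ _;
  exact: inner_content_ge0.
Qed.

Lemma outer_content_open U : open U -> outer_content U = inner_content U.
Proof.
move=> oU; apply/eqP; rewrite eq_le; apply/andP; split.
  by apply: ereal_inf_lbound; exists U => //; split.
by apply: le_ereal_inf_tmp => _ [V [_ UV] <-]; exact: le_inner_content.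
Qed.

Lemma outer_content_closed C : closed C -> (lam C)%:E <= outer_content C.
Proof.
by move=> cC; apply: le_ereal_inf_tmp => _ [V [_ CV] <-]; exact: inner_content_ge.
Qed.

Lemma outer_content_ge0 A : 0 <= outer_content A.
Proof.
by apply: le_ereal_inf_tmp => _ [V _ <-]; exact: inner_content_ge0.
Qed.

Lemma outer_content0 : outer_content set0 = 0.
Proof.
by rewrite outer_content_open ?inner_content0//; exact: open0.
Qed.

Lemma le_outer_content : {homo outer_content : A B / A `<=` B >-> A <= B}.
Proof.
move=> A B AB; apply: ereal_inf_le_tmp => _ [U [oU BU] <-]; exists U => //.
by split=> //; exact: subset_trans BU.
Qed.

Lemma outer_content_fin A : outer_content A \is a fin_num.
Proof.
rewrite ge0_fin_numE ?outer_content_ge0//.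
apply: le_lt_trans (inner_content_ltoo setT).
by apply: ereal_inf_lbound; exists setT => //; split=> //; exact: openT.
Qed.

Lemma outer_content_sigma_subadditive : sigma_subadditive outer_content.
Proof.
move=> A; apply/lee_addgt0Pr => e e0.
rewrite (le_trans _ (epsilon_trick _ _ (ltW e0)))//; last first.
  by move=> n; exact: outer_content_ge0.
(* Open neighbourhoods chosen with errors [e / 2 ^ n.+1], whose sum is at most [e]. *)
have [U PU] : {U : (set T)^nat & forall n, [/\ open (U n), A n `<=` U n &
    inner_content (U n) <= outer_content (A n) + (e / (2 ^ n.+1)%:R)%:E]}.
  apply: (@choice _ _ (fun n U => [/\ open U, A n `<=` U &
    inner_content U <= outer_content (A n) + (e / (2 ^ n.+1)%:R)%:E])) => n.
  have en : (0 < e / (2 ^ n.+1)%:R)%R by rewrite divr_gt0.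
  have [_ [V [oV AV] <-] VA] := lb_ereal_inf_adherent en (outer_content_fin (A n)).
  by exists V; split => //; exact: ltW.
apply: (@le_trans _ _ (inner_content (\bigcup_n U n))).
  apply: ereal_inf_lbound; exists (\bigcup_n U n) => //; split.
    by apply: bigcup_open => n _; have [] := PU n.
  by apply: subset_bigcup => n _; have [] := PU n.
apply: le_trans (inner_content_bigcup _) _; first by move=> n; have [] := PU n.
by apply: lee_nneseries => [n _ _|n _]; [exact: inner_content_ge0|have [] := PU n].
Qed.

HB.instance Definition _ := isOuterMeasure.Build R T outer_content
  outer_content0 outer_content_ge0 le_outer_content
  outer_content_sigma_subadditive.

(** For open [V] containing [X], approximate [V] inside [U] by a closed [C], then [V] minus [C] by a
    closed [D]. These are disjoint subsets of [V], so additivity of [lam] bounds the sum of their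
    contents by [inner_content V]. *)
Lemma caratheodory_measurable_open U : open U ->
  caratheodory_measurable outer_content U.
Proof.
move=> oU; apply: le_caratheodory_measurable => X.
apply: le_ereal_inf_tmp => _ [V [oV XV] <-].
apply: (@le_trans _ _ (inner_content (V `&` U) + outer_content (V `&` ~` U))).
  rewrite -(outer_content_open (openI oV oU)).
  by apply: leeD; apply: le_outer_content; exact: setSI.
rewrite -leeBrDr; last exact: outer_content_fin.
apply: ge_ereal_sup => _ [C [cC CVU] <-].
rewrite leeBrDr; last exact: outer_content_fin.
apply: (@le_trans _ _ ((lam C)%:E + inner_content (V `&` ~` C))).
  apply: leeD2l; apply: ereal_inf_lbound; exists (V `&` ~` C) => //; split.
    by apply: openI => //; exact: closed_openC.
  by apply: setIS; apply: subsetC => x /CVU[].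
rewrite addeC -leeBrDr; last by [].
apply: ge_ereal_sup => _ [D [cD DVC] <-].
rewrite leeBrDr; last by [].
rewrite -EFinD -lamU//.
  apply: inner_content_ge; first exact: closedU.
  by move=> x [/DVC[]|/CVU[]].
by apply/seteqP; split=> // x [/DVC[]].
Qed.

Lemma borel_caratheodory_measurable (A : set (borel T)) : measurable A ->
  caratheodory_measurable outer_content A.
Proof.
apply: smallest_sub => [|U]; last exact: caratheodory_measurable_open.
split=> [|B|F]; first exact: caratheodory_measurable_set0.
- by rewrite setTD; exact: caratheodory_measurable_setC.
- exact: caratheodory_measurable_bigcup.
Qed.

(** Retyped on [borel T] so that the measure structure is attached to the Borel sigma-algebra. *)
Definition content_measure : set (borel T) -> \bar R := outer_content.

Lemma content_measure_sigma_additive : semi_sigma_additive content_measure.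
Proof.
move=> F mF tF mUF.
apply: (@caratheodory_measure_sigma_additive R T outer_content) => //.
- by move=> n; exact: borel_caratheodory_measurable.
- exact: borel_caratheodory_measurable.
Qed.

HB.instance Definition _ := isMeasure.Build _ (borel T) R content_measure
  outer_content0 outer_content_ge0 content_measure_sigma_additive.

Lemma radon_content_measure : radon content_measure.
Proof.
split=> [C _ _|U oU|A _].
- by have := outer_content_fin C; rewrite ge0_fin_numE// outer_content_ge0.
- apply/eqP; rewrite eq_le; apply/andP; split.
    rewrite [leLHS]outer_content_open//; apply: ge_ereal_sup => _ [C [cC CU] <-].
    apply: le_trans (outer_content_closed cC) _.
    apply: ereal_sup_ubound; exists C => //; split=> //.
      exact: subclosed_compact cC compactT _.
    exact: closed_borel.
  by apply: ge_ereal_sup => _ [C [_ _ CU] <-]; exact: le_outer_content.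
- rewrite /= [LHS]/outer_content; congr ereal_inf; apply/seteqP.
  by split=> _ [U [oU AU] <-]; exists U => //=; rewrite /content_measure outer_content_open.
Qed.

Lemma radon_content_extension : exists mu : {measure set (borel T) -> \bar R},
  [/\ radon mu,
    forall U, open U -> mu U =
      ereal_sup [set (lam C)%:E | C in [set C | closed C /\ C `<=` U]] &
    forall C, closed C -> (lam C)%:E <= mu C].
Proof.
exists content_measure; split; first exact: radon_content_measure.
- exact: outer_content_open.
- exact: outer_content_closed.
Qed.

End ContentExtension.

(** * Limits of measures along an ultrafilter *)

(** An ultrafilter refining [f @ F] converges in the compact segment. Since [F] is ultra, a
    neighbourhood of the limit whose preimage is not in [F] would have its complement in the
    refinement. *)
Lemma ultra_fmap_cvg {R : realType} (I : Type) (F : set_system I) (f : I -> R)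
    (a b : R) :
  UltraFilter F -> (\forall i \near F, a <= f i <= b) -> cvg (f @ F).
Proof.
move=> FU fab; have FP : ProperFilter (f @ F) by exact: fmap_proper_filter.
have [G [GU FG]] := ultraFilterLemma FP.
have := @segment_compact R a b; rewrite compact_ultra => /(_ G GU)[|l [_ Gl]].
  by apply: FG; apply: filterS fab => i; rewrite /= in_itv.
apply/cvg_ex; exists l => A /Gl GA.
have [//|FA] := in_ultra_setVsetC (f @^-1` A) FU.
have /FG GA' : (f @ F) (~` A) by [].
have GP := @ultra_proper _ _ GU.
by case: (@filter_not_empty _ G _); rewrite -(setICr A); exact: filterI.
Qed.

(* [nu] is a vague cluster point of the [mu i]; the two bounds are those of the
   portmanteau theorem. *)
Lemma radon_cluster {R : realType} {T : ptopologicalType} (I : Type)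
    (F : set_system I) (mu : I -> {measure set (borel T) -> \bar R}) :
  hausdorff_space T -> compact [set: T] -> ProperFilter F ->
  (\forall i \near F, mu i [set: T] = 1%E) ->
  exists nu : {measure set (borel T) -> \bar R},
    [/\ radon nu,
      forall U (c : R), open U -> (\forall i \near F, (mu i U <= c%:E)%E) ->
        (nu U <= c%:E)%E &
      forall C (c : R), closed C -> (\forall i \near F, (c%:E <= mu i C)%E) ->
        (c%:E <= nu C)%E].
Proof.
move=> hausT compactT FF mu1; have [G [GU FG]] := ultraFilterLemma FF.
have {}mu1 := FG _ mu1; have GP := @ultra_proper _ _ GU.
(* [fine] sends infinite values to 0; along [G] this changes nothing on Borel sets, the total mass
   being eventually 1. *)
pose m A i : R := fine (mu i A).
have muE (A : set (borel T)) : measurable A ->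
    \forall i \near G, (m A i)%:E = mu i A /\ (mu i A <= 1)%E.
  move=> mA; apply: filterS mu1 => i mui1.
  have le1 : (mu i A <= 1)%E.
    by rewrite -mui1; apply: le_measure; rewrite ?inE//; exact: measurableT.
  split=> //; rewrite /m fineK// ge0_fin_numE//.
  by apply: le_lt_trans le1 _; exact: ltry.
have m_cvg (A : set (borel T)) : measurable A -> cvg (m A @ G).
  move=> mA; apply: (@ultra_fmap_cvg _ _ _ _ 0 1) => //.
  apply: filterS (muE _ mA) => i [mE le1]; rewrite -!lee_fin mE le1.
  by rewrite measure_ge0.
pose lam A : R := lim (m A @ G).
have cm C : closed C -> (m C @ G --> lam C) /\ measurable (C : set (borel T)).
  by move=> cC; split; [apply: m_cvg|]; exact: closed_borel.
have [||||nu [radnu nuU nuC]] := @radon_content_extension R T lam hausT compactT.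
- rewrite /lam (_ : m set0 = cst 0); first exact: lim_cst.
  by apply/funext => i; rewrite /m measure0.
(* Monotonicity and subadditivity pass to the limit as nonnegativity of a limit of differences. *)
- move=> C D /cm[Cl mC] /cm[Dl mD] CD; rewrite -subr_ge0.
  apply: (cvgr_to_ge (cvgB Dl Cl)); apply: filterS2 (muE _ mC) (muE _ mD).
  move=> i [CE _] [DE _]; rewrite subr_ge0 -lee_fin CE DE.
  by apply: le_measure; rewrite ?inE.
- move=> C D cC cD; have [[Cl mC] [Dl mD]] := (cm _ cC, cm _ cD).
  have [CDl mCD] := cm _ (closedU cC cD); rewrite -subr_ge0.
  apply: (cvgr_to_ge (cvgB (cvgD Cl Dl) CDl)).
  apply: filterS3 (muE _ mC) (muE _ mD) (muE _ mCD).
  move=> i [CE _] [DE _] [CDE _].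
  by rewrite subr_ge0 -lee_fin EFinD CE DE CDE; exact: measureU2.
- move=> C D cC cD CD0; have [[Cl mC] [Dl mD]] := (cm _ cC, cm _ cD).
  apply: cvg_lim => //; apply: cvg_trans (cvgD Cl Dl); apply: near_eq_cvg.
  apply: filterS3 (muE _ mC) (muE _ mD) (muE _ (measurableU _ _ mC mD)).
  move=> i [CE _] [DE _] [CDE _].
  by apply: EFin_inj; rewrite EFinD CE DE CDE measureU.
exists nu; split=> // [U c oU /FG Uc|C c cC /FG Cc].
  rewrite nuU//; apply: ge_ereal_sup => _ [C [cC CU] <-]; rewrite lee_fin.
  have [Cl mC] := cm _ cC; apply: (cvgr_to_le Cl).
  apply: filterS2 Uc (muE _ mC) => i Uc [CE _]; rewrite -lee_fin CE.
  apply: le_trans Uc; apply: le_measure; rewrite ?inE//.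
  exact: open_borel.
apply: le_trans (nuC _ cC); rewrite lee_fin.
have [Cl mC] := cm _ cC; apply: (cvgr_to_ge Cl).
by apply: filterS2 Cc (muE _ mC) => i Cc [CE _]; rewrite -lee_fin CE.
Qed.

(** * The filter of tails of the net, and the representing measure *)

Lemma fset_cofinal_filter (K : choiceType) :
  ProperFilter (filter_from setT (fun F0 : {fset K} =>
    [set F : {fset K} | (F0 `<=` F)%fset])).
Proof.
apply: filter_from_proper => [|F _]; last by exists F => /=.
apply: filter_from_filter; first by exists fset0.
move=> F1 F2 _ _; exists (F1 `|` F2)%fset => // F /=.
by rewrite fsubUset => /andP[].
Qed.

Theorem theorem4p3 (R : realType) (d : Order.disp_t) (K : tLatticeType d)
    (domK : domain K)
    (top_way_below : way_below (\top%O : K) (\top%O : K))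
    (mulK : way_below_multiplicative K)
    (phi : K -> R) (phiS : scott_function phi)
    (H : set (scott_opens K)) (closedH : closed H) :
  (exists mu : {fset K} -> {measure set (borel (scott_opens K)) -> \bar R},
      approximates mu phi H) ->
  exists mu : {measure set (borel (scott_opens K)) -> \bar R},
    mu [set: scott_opens K] = 1%E /\ represents mu phi H.
Proof.
case=> mu mu_phi; have [phi0 phi_sup phi1] := phiS.
have FF := fset_cofinal_filter K; set F := filter_from _ _ in FF.
(* The tail above [[fset x]] makes the approximation condition at [x] hold eventually. *)
have nearF x : \forall F0 \near F, x \in F0.
  exists [fset x]%fset => // F0 /= /fsubsetP; apply; exact: fset11.
have hausS := hausdorff_scott_opens domK top_way_below.
have compS := compact_scott_opens domK top_way_below.
(* Total mass is thus the value at [\top], which is normalized to 1. *)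
have atT : @scott_opens_at _ K \top%O = setT.
  by apply/seteqP; split=> U // _; exact: scott_opens_top.
have mu1 : \forall F0 \near F, mu F0 [set: scott_opens K] = 1%E.
  apply: filterS (nearF \top%O) => F0 F0top.
  by have [_ _ muE] := mu_phi F0; rewrite -atT -muE// phi1.
have [nu [radnu nuU nuC]] := radon_cluster hausS compS FF mu1.
have nuH : nu (~` H) = 0%E.
  apply/eqP; rewrite eq_le measure_ge0 andbT; apply: nuU.
    exact: closed_openC.
  by apply: nearW => F0; have [_ -> _] := mu_phi F0.
have mat x := open_borel (@open_scott_opens_at _ K x).
have nu_phi x : nu (scott_opens_at x) = (phi x)%:E.
  apply/eqP; rewrite eq_le; apply/andP; split.
    apply: nuU; first exact: open_scott_opens_at.
    by apply: filterS (nearF x) => F0 F0x; have [_ _ <-] := mu_phi F0.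
  rewrite phi_sup; apply: ge_ereal_sup => _ [z zx <-].
  have [W WE] := scott_opens_way_below domK top_way_below z.
  have [zW Wx] := scott_opens_at_sub_ge WE zx.
  have mW := closed_borel (@closed_scott_opens_ge _ _ W).
  apply: (@le_trans _ _ (nu [set V | val W `<=` val V])); last first.
    by apply: le_measure; rewrite ?inE.
  apply: nuC; first exact: closed_scott_opens_ge.
  apply: filterS (nearF z) => F0 F0z; have [_ _ muE] := mu_phi F0.
  by rewrite muE//; apply: le_measure; rewrite ?inE.
exists nu; split; first by rewrite -atT nu_phi phi1.
split=> // x; rewrite -nu_phi.
(* Split [S_x] along [H]; the part outside [H] is null by [nuH]. *)
rewrite (measureDI nu (mat x) (closed_borel closedH)) setIC.
rewrite [X in (X + _)%E](_ : _ = 0%E) ?add0e//.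
apply/eqP; rewrite eq_le measure_ge0 andbT -nuH.
apply: le_measure; rewrite ?inE.
- by apply: measurableD; [exact: mat|exact: closed_borel].
- by apply: open_borel; exact: closed_openC.
- by move=> U [].
Qed.
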